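(* Let $G$ be a small groupoid and let $S$ be a ring which is graded by $G$. The following assertions are equivalent: (a) the ring $S$ is epsilon-strongly graded; (b) every graded left $S$-module is epsilon-strongly graded; (c) every graded right $S$-module is epsilon-strongly graded.
   Context: Rings are associative and unital; the zero ring is allowed, with identity $0$. For the groupoid $G$: $G_0$ objects (identified with identity morphisms), $G_1$ morphisms, $d(g),c(g)$ domain and codomain, $G_2=\{(g,h):d(g)=c(h)\}$ composable pairs with composite $gh$. For additive subgroups, $XY$ denotes the set of finite sums of products $xy$. A unital ideal is a two-sided ideal having a multiplicative identity. A ring $S$ is $G$-graded if $S=\oplus_{g\in G_1}S_g$ for additive subgroups $S_g$ with $S_gS_h\subseteq S_{gh}$ if $(g,h)\in G_2$ and $S_gS_h=\{0\}$ otherwise. It is epsilon-strongly graded if for each $g\in G_1$, $S_gS_{g^{-1}}$ is a unital ideal of $S_{c(g)}$, and for all $(g,h)\in G_2$, $S_gS_h=S_gS_{g^{-1}}S_{gh}=S_{gh}S_{h^{-1}}S_h$. A graded left (right) $S$-module $M$ is a left (right) $S$-module with additive subgroups $M_g$, $g\in G_1$, such that $M=\oplus_{g\in G_1}M_g$ and, for all $g,h\in G_1$, $S_gM_h\subseteq M_{gh}$ (respectively $M_gS_h\subseteq M_{gh}$) if $(g,h)\in G_2$, and $S_gM_h=\{0\}$ (respectively $M_gS_h=\{0\}$) otherwise. It is epsilon-strongly graded if for each $g\in G_1$, $S_gS_{g^{-1}}$ is a unital ideal of $S_{c(g)}$, and for all $(g,h)\in G_2$, $S_gM_h=S_gS_{g^{-1}}M_{gh}$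 (respectively $M_gS_h=M_{gh}S_{h^{-1}}S_h$). *)

(* Defs.v *)
From HB Require Import structures.
From mathcomp Require Import all_boot all_order all_algebra.
From mathcomp Require Import boolp classical_sets.

Set Implicit Arguments.
Unset Strict Implicit.
Unset Printing Implicit Defensive.

Import GRing.Theory.
Local Open Scope classical_set_scope.
Local Open Scope ring_scope.

(* The composite [comp g h] ("g after h") is a total function whose value is
   only meaningful on composable pairs, i.e. when [dom g = cod h]; every axiom
   about it is relativised to such pairs. *)
Record groupoid := Groupoid {
  obj : Type;
  mor : Type;
  dom : mor -> obj;
  cod : mor -> obj;
  idm : obj -> mor;
  comp : mor -> mor -> mor;
  inv : mor -> mor;
  dom_idm : forall e, dom (idm e) = e;
  cod_idm : forall e, cod (idm e) = e;
  dom_comp : forall g h, dom g = cod h -> dom (comp g h) = dom h;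
  cod_comp : forall g h, dom g = cod h -> cod (comp g h) = cod g;
  comp_assoc : forall g h k, dom g = cod h -> dom h = cod k ->
    comp g (comp h k) = comp (comp g h) k;
  comp_idl : forall g, comp (idm (cod g)) g = g;
  comp_idr : forall g, comp g (idm (dom g)) = g;
  dom_inv : forall g, dom (inv g) = cod g;
  cod_inv : forall g, cod (inv g) = dom g;
  comp_invl : forall g, comp (inv g) g = idm (dom g);
  comp_invr : forall g, comp g (inv g) = idm (cod g)
}.

Definition composable (G : groupoid) (g h : mor G) : Prop := dom g = cod h.

(* Independence is stated on finite families of pairwise distinct indices, so
   that the index type needs no decidable equality. *)
Definition direct_sum (I : Type) (V : zmodType) (A : I -> set V) : Prop :=
  [/\ forall i, zmod_closed [in A i],
      forall x : V, exists n (i : 'I_n -> I) (a : 'I_n -> V),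
        (forall k, A (i k) (a k)) /\ x = \sum_k a k
    & forall n (i : 'I_n -> I) (a : 'I_n -> V), injective i ->
        (forall k, A (i k) (a k)) -> \sum_k a k = 0 -> forall k, a k = 0].

Definition sums_of (U V : Type) (W : zmodType) (op : U -> V -> W)
    (X : set U) (Y : set V) : set W :=
  [set z | exists n (x : 'I_n -> U) (y : 'I_n -> V),
     [/\ forall i, X (x i), forall i, Y (y i)
       & z = \sum_i op (x i) (y i)]].

(* A right module over [S] is a left module over the converse ring [S^c]. *)
Definition rscale (S : pzRingType) (M : lmodType S^c) (m : M) (s : S) : M :=
  (s : S^c) *: m.

Definition mulS (S : pzRingType) (X Y : set S) : set S :=
  sums_of (fun x y : S => x * y) X Y.

Definition scaleS (S : pzRingType) (M : lmodType S) (X : set S) (Y : set M) :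
  set M := sums_of (fun (x : S) (y : M) => x *: y) X Y.

Definition rscaleS (S : pzRingType) (M : lmodType S^c) (Y : set M)
    (X : set S) : set M := sums_of (@rscale S M) Y X.

(* [A] plays the role of the ring in which [I] is an ideal; its multiplication
   is that of [S], but its identity need not be [1]. *)
Definition unital_ideal (S : pzRingType) (A I : set S) : Prop :=
  [/\ I `<=` A,
      zmod_closed [in I],
      forall a x, A a -> I x -> I (a * x) /\ I (x * a)
    & exists2 e, I e & forall x, I x -> e * x = x /\ x * e = x].

Section Graded.
Variables (G : groupoid) (S : pzRingType) (Sg : mor G -> set S).

Definition graded_ring : Prop :=
  [/\ direct_sum Sg,
      forall g h, composable g h -> mulS (Sg g) (Sg h) `<=` Sg (comp g h)
    & forall g h, ~ composable g h -> mulS (Sg g) (Sg h) = [set 0]].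

Definition unital_components : Prop :=
  forall g, unital_ideal (Sg (idm (cod g))) (mulS (Sg g) (Sg (inv g))).

Definition eps_strongly_graded_ring : Prop :=
  unital_components /\
  forall g h, composable g h ->
    mulS (Sg g) (Sg h) = mulS (mulS (Sg g) (Sg (inv g))) (Sg (comp g h)) /\
    mulS (mulS (Sg g) (Sg (inv g))) (Sg (comp g h)) =
      mulS (mulS (Sg (comp g h)) (Sg (inv h))) (Sg h).

Definition graded_lmodule (M : lmodType S) (Mg : mor G -> set M) : Prop :=
  [/\ direct_sum Mg,
      forall g h, composable g h -> scaleS (Sg g) (Mg h) `<=` Mg (comp g h)
    & forall g h, ~ composable g h -> scaleS (Sg g) (Mg h) = [set 0]].

Definition eps_strongly_graded_lmodule (M : lmodType S) (Mg : mor G -> set M) :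
    Prop :=
  unital_components /\
  forall g h, composable g h ->
    scaleS (Sg g) (Mg h) = scaleS (mulS (Sg g) (Sg (inv g))) (Mg (comp g h)).

Definition graded_rmodule (M : lmodType S^c) (Mg : mor G -> set M) : Prop :=
  [/\ direct_sum Mg,
      forall g h, composable g h -> rscaleS (Mg g) (Sg h) `<=` Mg (comp g h)
    & forall g h, ~ composable g h -> rscaleS (Mg g) (Sg h) = [set 0]].

Definition eps_strongly_graded_rmodule (M : lmodType S^c)
    (Mg : mor G -> set M) : Prop :=
  unital_components /\
  forall g h, composable g h ->
    rscaleS (Mg g) (Sg h) = rscaleS (rscaleS (Mg (comp g h)) (Sg (inv h))) (Sg h).

End Graded.

(* Main.v *)
Require Import Defs.
From mathcomp Require Import all_boot all_order all_algebra.
From mathcomp Require Import boolp classical_sets.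

Set Implicit Arguments.
Unset Strict Implicit.
Unset Printing Implicit Defensive.

Import GRing.Theory.
Local Open Scope classical_set_scope.
Local Open Scope ring_scope.

(** All three assertions are equivalent to the same intrinsic condition on the
    ring, [symmetrically_graded]: the ideals [S_g S_{g^-1}] are unital and
    [S_g] is contained in [S_g S_{g^-1} S_g] for every morphism [g].

    That condition gives the module identities by associativity. On the left,
    [S_g M_h] is contained in [S_g S_{g^-1} S_g M_h], hence in
    [S_g S_{g^-1} M_{gh}], and conversely [S_{g^-1} M_{gh}] is contained in
    [M_h] ([symmetrically_graded_lmodule]); the right side is the mirror image
    ([symmetrically_graded_rmodule]). The two identities required of the ring
    are these statements for [S] as a left and as a right module over itself.

    Conversely, taking [h] (or [g]) to be an identity morphism in any one of
    the identities for [S] turns it into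
    [S_g S_{d(g)} = S_g S_{g^-1} S_g] (or [S_{c(g)} S_g = S_g S_{g^-1} S_g]).
    What is then needed is that [S_g] is contained in [S_g S_{d(g)}] and in
    [S_{c(g)} S_g], and this is where the identity of [S] enters: for [x] in
    [S_g], decompose [1] into homogeneous terms and compare the components of
    degree [g] on both sides of [x = x 1]. Since [g k = g] forces [k] to be an
    identity morphism, only the terms of [1] of degree [d(g)] contribute. *)

(** * Finite sums of products *)

Definition biadditive (U V W : zmodType) (op : U -> V -> W) : Prop :=
  (forall x y z, op (x + y) z = op x z + op y z) /\
  (forall x y z, op x (y + z) = op x y + op x z).

Lemma biadditive_suml (U V W : zmodType) (op : U -> V -> W) n
    (x : 'I_n -> U) (y : V) :
  biadditive op -> op (\sum_k x k) y = \sum_k op (x k) y.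
Proof.
move=> [opDl _]; apply: (big_morph (op^~ y)) => [a b|]; first exact: opDl.
by apply: (addrI (op 0 y)); rewrite -opDl !addr0.
Qed.

Lemma biadditive_sumr (U V W : zmodType) (op : U -> V -> W) n
    (x : U) (y : 'I_n -> V) :
  biadditive op -> op x (\sum_k y k) = \sum_k op x (y k).
Proof.
move=> [_ opDr]; apply: (big_morph (op x)) => [a b|]; first exact: opDr.
by apply: (addrI (op x 0)); rewrite -opDr !addr0.
Qed.

Section SumsOf.
Variables (U V : Type) (W : zmodType) (op : U -> V -> W).
Implicit Types (X : set U) (Y : set V).

Lemma sums_of_op X Y x y : X x -> Y y -> sums_of op X Y (op x y).
Proof.
by move=> Xx Yy; exists 1%N, (fun=> x), (fun=> y); rewrite big_ord1.
Qed.

Lemma sums_of0 X Y : sums_of op X Y 0.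
Proof.
have ord0_elim T (i : 'I_0) : T by case: i.
by exists 0%N, (ord0_elim U), (ord0_elim V); split; rewrite ?big_ord0 // => -[].
Qed.

Lemma sums_ofD X Y z t :
  sums_of op X Y z -> sums_of op X Y t -> sums_of op X Y (z + t).
Proof.
move=> [n [x [y [Xx Yy ->]]]] [m [x' [y' [Xx' Yy' ->]]]].
exists (n + m)%N,
  (fun i => match split i with inl k => x k | inr k => x' k end),
  (fun i => match split i with inl k => y k | inr k => y' k end).
split=> [i|i|]; [by case: split | by case: split |].
by rewrite big_split_ord; congr (_ + _); apply: eq_bigr => i _;
  rewrite ?(unsplitK (inl i)) ?(unsplitK (inr i)).
Qed.

Lemma sums_of_sum X Y n (z : 'I_n -> W) :
  (forall k, sums_of op X Y (z k)) -> sums_of op X Y (\sum_k z k).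
Proof.
move=> XYz; apply: big_ind => [|a b|k _]; [exact: sums_of0 | exact: sums_ofD |].
exact: XYz.
Qed.

Lemma sums_ofS X X' Y Y' :
  X `<=` X' -> Y `<=` Y' -> sums_of op X Y `<=` sums_of op X' Y'.
Proof.
move=> XX' YY' _ [n [x [y [Xx Yy ->]]]]; exists n, x, y.
by split=> // i; [apply: XX' | apply: YY'].
Qed.

End SumsOf.

(** Four different operations are needed because the products of [S] are
    associated with the left and the right actions of [S] on modules. *)
Lemma sums_ofA (U V T P Q W : zmodType)
    (op1 : U -> V -> P) (op2 : P -> T -> W)
    (op3 : V -> T -> Q) (op4 : U -> Q -> W)
    (X : set U) (Y : set V) (Z : set T) :
  biadditive op2 -> biadditive op4 ->
  (forall x y z, op2 (op1 x y) z = op4 x (op3 y z)) ->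
  sums_of op2 (sums_of op1 X Y) Z = sums_of op4 X (sums_of op3 Y Z).
Proof.
move=> op2D op4D opA; apply/seteqP; split=> _ [n [p [q [Xp Yq ->]]]];
  apply: sums_of_sum => i.
- have [m [x [y [Xx Yy ->]]]] := Xp i; rewrite biadditive_suml //.
  apply: sums_of_sum => k; rewrite opA.
  by apply: sums_of_op => //; apply: sums_of_op.
- have [m [y [z [Yy Zz ->]]]] := Yq i; rewrite biadditive_sumr //.
  apply: sums_of_sum => k; rewrite -opA.
  by apply: sums_of_op => //; apply: sums_of_op.
Qed.

Lemma biadditive_scale (S : pzRingType) (M : lmodType S) :
  biadditive (fun (x : S) (m : M) => x *: m).
Proof. by split=> x y z; rewrite ?scalerDl ?scalerDr. Qed.

Lemma biadditive_rscale (S : pzRingType) (M : lmodType S^c) :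
  biadditive (@rscale S M).
Proof. by split=> x y z; rewrite /rscale ?scalerDr // scalerDl. Qed.

Lemma scaleSA (S : pzRingType) (M : lmodType S) (X Y : set S) (Z : set M) :
  scaleS (mulS X Y) Z = scaleS X (scaleS Y Z).
Proof.
apply: sums_ofA => [||x y m]; try exact: biadditive_scale.
by rewrite scalerA.
Qed.

Lemma rscaleSA (S : pzRingType) (M : lmodType S^c) (Z : set M) (X Y : set S) :
  rscaleS (rscaleS Z X) Y = rscaleS Z (mulS X Y).
Proof.
apply: sums_ofA => [||m x y]; try exact: biadditive_rscale.
by rewrite /rscale scalerA.
Qed.

(** * Homogeneous components *)

Section DirectSum.
Variables (I : Type) (V : zmodType) (A : I -> set V).
Hypothesis dA : direct_sum A.

Lemma direct_sum0 i : A i 0.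
Proof. by have [/(_ i)[]] := dA; rewrite inE. Qed.

Lemma direct_sumN i x : A i x -> A i (- x).
Proof.
have [/(_ i)[A0 AB] _ _] := dA; move=> Ax.
by have := AB 0 x A0; rewrite sub0r !inE; apply.
Qed.

Lemma direct_sumD i x y : A i x -> A i y -> A i (x + y).
Proof.
have [/(_ i)[_ AB] _ _] := dA; move=> Ax /direct_sumN Ay.
by have := AB x (- y); rewrite opprK !inE; apply.
Qed.

(** Directness is assumed for pairwise distinct degrees; repetitions are
    allowed here by summing the terms of equal degree first. *)
Lemma direct_sum_component0 n (j : 'I_n -> {classic I}) (a : 'I_n -> V) :
  (forall k, A (j k) (a k)) -> \sum_k a k = 0 ->
  forall i, \sum_(k | j k == i) a k = 0.
Proof.
move=> Aa a0 i.
pose s := undup (map j (enum 'I_n)).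
have js k : j k \in s by rewrite mem_undup map_f // mem_enum.
pose deg (l : 'I_(size s)) := tnth (in_tuple s) l.
have deg_inj : injective deg.
  by apply/tuple_uniqP; rewrite /= undup_uniq.
pose b l := \sum_(k | j k == deg l) a k.
have Ab l : A (deg l) (b l).
  apply: big_ind => [|x y|k /eqP <- //]; first exact: direct_sum0.
  exact: direct_sumD.
have b0 : \sum_l b l = 0.
  rewrite -[RHS]a0 (exchange_big_dep predT) //=; apply: eq_bigr => k _.
  have /tnthP[l jk] : j k \in in_tuple s by exact: js.
  rewrite (big_pred1 l) // => l' /=.
  by rewrite jk eq_sym (inj_eq deg_inj).
have [_ _ free] := dA.
have bl := free _ deg b deg_inj Ab b0.
have [/(tnthP (in_tuple s))[l ->]|si] := boolP (i \in s); first exact: bl.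
by rewrite big_pred0 // => k; apply: contraNF si => /eqP <-.
Qed.

Lemma direct_sum_component n (j : 'I_n -> {classic I}) (a : 'I_n -> V)
    (i : {classic I}) :
  (forall k, A (j k) (a k)) -> A i (\sum_k a k) ->
  \sum_k a k = \sum_(k | j k == i) a k.
Proof.
move=> Aa; set x := LHS => Ax.
(* The relation - x + \sum_k a k = 0, where the term - x, put at index 0, has
   degree i. *)
pose j' k := if unlift ord0 k is Some l then j l else i.
pose a' k := if unlift ord0 k is Some l then a l else - x.
have Aa' k : A (j' k) (a' k).
  by rewrite /j' /a'; case: unliftP => [l|] _ //; exact: direct_sumN.
have a'0 : \sum_k a' k = 0.
  rewrite big_ord_recl /a' unlift_none.
  by under eq_bigr do rewrite liftK; rewrite addNr.
have := direct_sum_component0 Aa' a'0 i.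
rewrite big_mkcond big_ord_recl /j' /a' unlift_none eqxx.
under eq_bigr do rewrite liftK.
rewrite -big_mkcond => sum0; apply: (addrI (- x)).
by rewrite addNr; exact/esym/sum0.
Qed.

End DirectSum.

(** * Identities of a groupoid *)

(* The names inv, comp and dom also belong to other modules; from here on they
   are the operations of a groupoid. *)
Import Defs.

Section Groupoid.
Variable G : groupoid.
Implicit Types g h k : mor G.

Lemma comp_invK g h : composable g h -> comp (inv g) (comp g h) = h.
Proof.
move=> gh; rewrite comp_assoc ?dom_inv // comp_invl.
by rewrite gh comp_idl.
Qed.

Lemma comp_Kinv g h : composable g h -> comp (comp g h) (inv h) = g.
Proof.
move=> gh; rewrite -comp_assoc ?cod_inv // comp_invr.
by rewrite -gh comp_idr.
Qed.

Lemma composable_invl g h : composable g h -> composable (inv g) (comp g h).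
Proof. by move=> gh; rewrite /composable dom_inv cod_comp. Qed.

Lemma composable_invr g h : composable g h -> composable (comp g h) (inv h).
Proof. by move=> gh; rewrite /composable cod_inv dom_comp. Qed.

Lemma composable_idr g : composable g (idm (dom g)).
Proof. by rewrite /composable cod_idm. Qed.

Lemma composable_idl g : composable (idm (cod g)) g.
Proof. by rewrite /composable dom_idm. Qed.

Lemma comp_eq_idr g k : composable g k -> comp g k = g -> k = idm (dom g).
Proof. by move=> gk e; rewrite -(comp_invK gk) e comp_invl. Qed.

Lemma comp_eq_idl k g : composable k g -> comp k g = g -> k = idm (cod g).
Proof. by move=> kg e; rewrite -(comp_Kinv kg) e comp_invr. Qed.

End Groupoid.

(** * Graded rings and their modules *)

Section GradedRing.
Variables (G : groupoid) (S : pzRingType) (Sg : mor G -> set S).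
Hypothesis hS : graded_ring Sg.

Lemma graded_mul g h x y :
  composable g h -> Sg g x -> Sg h y -> Sg (comp g h) (x * y).
Proof.
by have [_ SS _] := hS => gh Sx Sy; apply: SS gh _ _; apply: sums_of_op.
Qed.

Lemma graded_mul0 g h x y : ~ composable g h -> Sg g x -> Sg h y -> x * y = 0.
Proof.
have [_ _ S0] := hS => gh Sx Sy.
have: mulS (Sg g) (Sg h) (x * y) by apply: sums_of_op.
by rewrite S0.
Qed.

(** The degree-[g] component of [x = x 1]. A term of [1] whose degree is not
    composable with [g] is annihilated by [x], so it may be given degree [g]. *)
Lemma graded_sub_mulr g : Sg g `<=` mulS (Sg g) (Sg (idm (dom g))).
Proof.
move=> x Sx; have [dS _ _] := hS; have [_ /(_ 1)[n [i [a [Sa one]]]] _] := dS.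
pose j k : {classic mor G} :=
  if pselect (composable g (i k)) then comp g (i k) else g.
have Sxa k : Sg (j k) (x * a k).
  rewrite /j; case: pselect => gi; first exact: graded_mul.
  by rewrite (graded_mul0 gi Sx (Sa k)); exact: direct_sum0.
have xE : x = \sum_k x * a k by rewrite -mulr_sumr -one mulr1.
have -> : x = \sum_(k | j k == g) x * a k.
  by rewrite {1}xE; apply: (direct_sum_component dS); rewrite -?xE.
apply: big_ind => [|y z|k /eqP]; [exact: sums_of0 | exact: sums_ofD |].
rewrite /j; case: pselect => [gi /(comp_eq_idr gi) ik|gi _].
  by apply: sums_of_op; rewrite -?ik.
by rewrite (graded_mul0 gi Sx (Sa k)); exact: sums_of0.
Qed.

Lemma graded_sub_mull g : Sg g `<=` mulS (Sg (idm (cod g))) (Sg g).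
Proof.
move=> x Sx; have [dS _ _] := hS; have [_ /(_ 1)[n [i [a [Sa one]]]] _] := dS.
pose j k : {classic mor G} :=
  if pselect (composable (i k) g) then comp (i k) g else g.
have Sax k : Sg (j k) (a k * x).
  rewrite /j; case: pselect => ig; first exact: graded_mul.
  by rewrite (graded_mul0 ig (Sa k) Sx); exact: direct_sum0.
have xE : x = \sum_k a k * x by rewrite -mulr_suml -one mul1r.
have -> : x = \sum_(k | j k == g) a k * x.
  by rewrite {1}xE; apply: (direct_sum_component dS); rewrite -?xE.
apply: big_ind => [|y z|k /eqP]; [exact: sums_of0 | exact: sums_ofD |].
rewrite /j; case: pselect => [ig /(comp_eq_idl ig) ik|ig _].
  by apply: sums_of_op; rewrite -?ik.
by rewrite (graded_mul0 ig (Sa k) Sx); exact: sums_of0.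
Qed.

(** Each of the three assertions yields the inclusion on [Sg g] when one of the
    two morphisms is an identity. Conversely, [Sg g] can be expanded by it next
    to a module component on either side, which recovers the general case. *)
Definition symmetrically_graded : Prop :=
  unital_components Sg /\
  forall g, Sg g `<=` mulS (mulS (Sg g) (Sg (inv g))) (Sg g).

Lemma symmetrically_graded_lmodule (M : lmodType S) (Mg : mor G -> set M) :
  symmetrically_graded -> graded_lmodule Sg Mg ->
  eps_strongly_graded_lmodule Sg Mg.
Proof.
move=> [uS symS] [_ SM _]; split=> // g h gh; apply/seteqP; split.
- have sub : scaleS (Sg g) (Mg h) `<=`
      scaleS (mulS (mulS (Sg g) (Sg (inv g))) (Sg g)) (Mg h).
    exact: sums_ofS.
  apply: subset_trans sub _; rewrite scaleSA.
  by apply: sums_ofS; last exact: SM.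
- rewrite scaleSA; apply: sums_ofS => //.
  by rewrite -{2}(comp_invK gh); apply/SM/composable_invl.
Qed.

Lemma symmetrically_graded_rmodule (M : lmodType S^c) (Mg : mor G -> set M) :
  symmetrically_graded -> graded_rmodule Sg Mg ->
  eps_strongly_graded_rmodule Sg Mg.
Proof.
move=> [uS symS] [_ MS _]; split=> // g h gh; apply/seteqP; split.
- have sub : rscaleS (Mg g) (Sg h) `<=`
      rscaleS (Mg g) (mulS (mulS (Sg h) (Sg (inv h))) (Sg h)).
    exact: sums_ofS.
  apply: subset_trans sub _; rewrite -!rscaleSA.
  by do 2![apply: sums_ofS => //]; exact: MS.
- apply: sums_ofS => //.
  by rewrite -{2}(comp_Kinv gh); apply/MS/composable_invr.
Qed.

(** The action of [S] on its regular left module, and that of the converse ring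
    on its own regular module read from the right, both unfold to the product
    of [S], in the same order; hence the conversions here and below. *)
Lemma graded_lregular : graded_lmodule (M := S^o) Sg Sg.
Proof. exact: hS. Qed.

Lemma graded_rregular : graded_rmodule (M := (S^c)^o) Sg Sg.
Proof. exact: hS. Qed.

Lemma symmetrically_graded_of_lregular :
  eps_strongly_graded_lmodule (M := S^o) Sg Sg -> symmetrically_graded.
Proof.
move=> [uS eqS]; split=> // g; apply: subset_trans (@graded_sub_mulr g) _.
have := eqS g _ (composable_idr g).
by rewrite comp_idr => eg; rewrite -[mulS (mulS _ _) _]eg.
Qed.

Lemma symmetrically_graded_of_rregular :
  eps_strongly_graded_rmodule (M := (S^c)^o) Sg Sg -> symmetrically_graded.
Proof.
move=> [uS eqS]; split=> // g; apply: subset_trans (@graded_sub_mull g) _.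
have := eqS _ g (composable_idl g).
by rewrite comp_idl => eg; rewrite -[mulS (mulS _ _) _]eg.
Qed.

Lemma eps_strongly_graded_ringE :
  eps_strongly_graded_ring Sg <-> symmetrically_graded.
Proof.
split=> [[uS eqS]|symS].
  apply: symmetrically_graded_of_lregular; split=> // g h gh.
  by have [] := eqS g h gh.
have [uS eqL] := symmetrically_graded_lmodule symS graded_lregular.
have [_ eqR] := symmetrically_graded_rmodule symS graded_rregular.
split=> // g h gh; have eL := eqL g h gh; have eR := eqR g h gh.
by split; [exact: eL | exact: etrans (esym eL) eR].
Qed.

End GradedRing.

Theorem proposition47 (G : groupoid) (S : pzRingType) (Sg : mor G -> set S)
    (hS : graded_ring Sg) :
  [<-> eps_strongly_graded_ring Sg;
       forall (M : lmodType S) (Mg : mor G -> set M),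
         graded_lmodule Sg Mg -> eps_strongly_graded_lmodule Sg Mg;
       forall (M : lmodType S^c) (Mg : mor G -> set M),
         graded_rmodule Sg Mg -> eps_strongly_graded_rmodule Sg Mg].
Proof.
tfae=> [/(eps_strongly_graded_ringE hS) symS M Mg|left_eps M Mg|right_eps].
- exact: symmetrically_graded_lmodule.
- apply: symmetrically_graded_rmodule.
  apply: symmetrically_graded_of_lregular => //.
  exact/left_eps/graded_lregular.
- apply/eps_strongly_graded_ringE => //.
  apply: symmetrically_graded_of_rregular => //.
  exact/right_eps/graded_rregular.
Qed.
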